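(* Let $\bar t\in(0,\tfrac12)$, $B>0$, $\varepsilon\in\big(0,\tfrac{2\bar t}{1+2\bar t}\big)$, and $F\in\mathcal{F}_{\bar t,B}$. Let $Y_i\sim F$ and $D_i\sim\mathrm{Ber}(\varepsilon)$, for $i\in[n]$, all be drawn independently. Let $\{Z_i\}_{i\in[n]}$ be arbitrary random variables possibly depending on $\{Y_i,D_i\}_{i\in[n]}$, and define $X_i=(1-D_i)Y_i+D_iZ_i$. Then, for any confidence level $\delta\in(0,1)$, any error level $E>0$, and any number of samples $n\ge 2\max\left(\tfrac{B^2m_2(F)^2}{E^2},\left(\bar t-\tfrac{\varepsilon}{2(1-\varepsilon)}\right)^{-2}\right)\log\tfrac2\delta$, $$\mathbb{P}\Big(\left|\hat m_1(X_1,\dots,X_n)-m_1(F)\right|\le B\,m_2(F)\,\frac{\varepsilon}{2(1-\varepsilon)}+E\Big)\ge 1-\delta .$$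
   Context: Distributions are on $\mathbb{R}$ and identified with their cdfs; $[n]=\{1,\dots,n\}$. For a cdf $F$, $Q_{L,F}(p)=\inf\{x:F(x)\ge p\}$ and $Q_{R,F}(p)=\inf\{x:F(x)>p\}$. The median of $F$ is $m_1(F)$ (when unique), and the median absolute deviation (MAD) is $m_2(F):=$ the median of $|X-m_1(F)|$ with $X\sim F$. The empirical median $\hat m_1(x_1,\dots,x_n)$ is the middle value if $n$ is odd and the average of the two middle values if $n$ is even. For $\bar t\in(0,\tfrac12)$ and $B>0$, $\mathcal{F}_{\bar t,B}$ is the family of distributions $F$ that have a unique median and satisfy $$|F(x_1)-F(x_2)|\ge\frac{1}{B\,m_2(F)}|x_1-x_2|\quad\text{for all }x_1,x_2\in\left[Q_{L,F}(\tfrac12-\bar t),\,Q_{R,F}(\tfrac12+\bar t)\right].$$ *)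

(* Defs.v *)
From HB Require Import structures.
From mathcomp Require Import all_boot all_order all_algebra.
From mathcomp Require Import all_classical all_reals all_analysis.

Set Implicit Arguments.
Unset Strict Implicit.
Unset Printing Implicit Defensive.

Import Order.TTheory GRing.Theory Num.Theory.
Import numFieldNormedType.Exports.

Local Open Scope classical_set_scope.
Local Open Scope ring_scope.

Section Quantiles.
Context {R : realType}.

Definition law_cdf (mu : probability R R) (x : R) : R := fine (mu `]-oo, x]%classic).

Definition quantileL (F : R -> R) (p : R) : R := inf [set x | p <= F x].

Definition quantileR (F : R -> R) (p : R) : R := inf [set x | p < F x].

Definition is_median (F : R -> R) (m : R) : Prop :=
  quantileL F 2^-1 <= m <= quantileR F 2^-1.

Definition unique_median (F : R -> R) : Prop :=
  exists m, forall x, is_median F x <-> x = m.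

(* Only meaningful when [unique_median F] holds: it is then the median. *)
Definition median (F : R -> R) : R := quantileL F 2^-1.

Definition absdev_cdf (mu : probability R R) (r : R) : R :=
  fine (mu [set x | `|x - median (law_cdf mu)| <= r]).

(* A relation, because the distribution of |X - m_1| may have several medians
   even when that of X has only one. *)
Definition is_mad (mu : probability R R) (m2 : R) : Prop :=
  is_median (absdev_cdf mu) m2.

(* [0 < m2] makes the quotient meaningful: a median absolute deviation is
   nonnegative, and 0^-1 = 0 would void the condition when m2 = 0. *)
Definition in_family (tbar B : R) (mu : probability R R) (m2 : R) : Prop :=
  let F := law_cdf mu in
  [/\ unique_median F,
      is_mad mu m2,
      0 < m2 &
      forall x1 x2 : R,
        quantileL F (2^-1 - tbar) <= x1 <= quantileR F (2^-1 + tbar) ->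
        quantileL F (2^-1 - tbar) <= x2 <= quantileR F (2^-1 + tbar) ->
        1 / (B * m2) * `|x1 - x2| <= `|F x1 - F x2|].

Definition empirical_median (xs : seq R) : R :=
  let s := sort <=%R xs in
  let n := size xs in
  if odd n then s`_(n./2) else (s`_(n./2).-1 + s`_(n./2)) / 2.

End Quantiles.

Section Independence.
Context d (Omega : measurableType d) (R : realType) (P : probability Omega R).

Definition has_law d' (T' : measurableType d') (X : {RV P >-> T'})
    (mu : set T' -> \bar R) : Prop :=
  forall A : set T', measurable A -> distribution P X A = mu A.

Definition generated_events d' (T' : measurableType d') (X : {RV P >-> T'}) :
    set (set Omega) :=
  preimage_set_system setT X measurable.

Definition mutually_independent (I : finType) (E : I -> set (set Omega)) : Prop :=
  forall (J : {set I}) (A : I -> set Omega),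
    (forall i, i \in J -> E i (A i)) ->
    P (\bigcap_(i in [set` J]) A i) = (\prod_(i in J) P (A i))%E.

Definition jointly_independent n (Y : 'I_n -> {RV P >-> R})
    (D : 'I_n -> {RV P >-> bool}) : Prop :=
  mutually_independent (fun k : 'I_n + 'I_n =>
    match k with
    | inl i => generated_events (Y i)
    | inr i => generated_events (D i)
    end).

Definition contaminate n (Y : 'I_n -> {RV P >-> R})
    (D : 'I_n -> {RV P >-> bool}) (Z : 'I_n -> {RV P >-> R})
    (i : 'I_n) (w : Omega) : R :=
  (1 - (D i w)%:R) * Y i w + (D i w)%:R * Z i w.

End Independence.

(* Main.v *)
Require Import Defs.
From HB Require Import structures.
From mathcomp Require Import all_boot all_order all_algebra.
From mathcomp Require Import all_classical all_reals all_analysis.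
From mathcomp Require Import measurable_realfun zify ring lra.

(** The number m = median(F) is compared with a = m + r, r = B m2 eps' + E, where
    eps' = eps / (2(1-eps)); the case of m - r is symmetric. If the empirical median
    exceeds a, then at least half of the X_i do, so at most half of the indices satisfy
    "D_i = 0 and Y_i <= a". These events do not involve the Z_i, they are independent,
    and they have probability (1-eps) F(a) >= 1/2 + (1-eps) t with
    t = min(tbar - eps', E / (B m2)), by the growth condition on F around m.
    A Chernoff bound gives probability at most exp(-2 (1-eps)^2 t^2 n), which is at
    most delta/2 since eps < 1/2 and n t^2 >= 2 log(2/delta). *)

Set Implicit Arguments.
Unset Strict Implicit.
Unset Printing Implicit Defensive.

Import Order.TTheory GRing.Theory Num.Theory.
Import numFieldNormedType.Exports.

Local Open Scope classical_set_scope.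
Local Open Scope ring_scope.

(** * Order statistics and the empirical median, read off from counts *)

Section OrderStatistics.
Context {R : realType}.
Implicit Types (xs : seq R) (p : pred R) (a c : R).

(** Sorting preserves counts, and monotonicity of [p] carries it from position [k] to every later
    entry of the sorted list. *)
Lemma nth_sort_count_up p xs k :
    (forall x y, x <= y -> p x -> p y) -> (k < size xs)%N ->
  p (sort <=%R xs)`_k -> (size xs - k <= count p xs)%N.
Proof.
move=> p_up kn pk; rewrite -(count_sort <=%R p xs).
set s := sort _ _ in pk *; have ss : size s = size xs by rewrite size_sort.
rewrite -[s in count _ s](cat_take_drop k) count_cat -ss -size_drop.
apply: leq_trans (leq_addl _ _).
suff : all p (drop k s) by rewrite all_count => /eqP->.
apply/(all_nthP 0) => i; rewrite size_drop nth_drop => ik.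
apply: p_up pk; apply: (sorted_leq_nth le_trans le_refl) => //.
- exact: sort_le_sorted.
- by rewrite inE ss.
- by rewrite inE -ltn_subRL.
- exact: leq_addr.
Qed.

Lemma nth_sort_count_down p xs k :
    (forall x y, x <= y -> p y -> p x) -> (k < size xs)%N ->
  p (sort <=%R xs)`_k -> (k < count p xs)%N.
Proof.
move=> p_down kn pk; rewrite -(count_sort <=%R p xs).
set s := sort _ _ in pk *; have ss : size s = size xs by rewrite size_sort.
rewrite -[s in count _ s](cat_take_drop k.+1) count_cat.
apply: leq_trans (leq_addr _ _).
suff : all p (take k.+1 s) by rewrite all_count => /eqP->; rewrite size_takel // ss.
apply/(all_nthP 0) => i; rewrite size_takel ?ss // => ik.
rewrite nth_take //; apply: p_down pk.
apply: (sorted_leq_nth le_trans le_refl) => //.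
- exact: sort_le_sorted.
- by rewrite inE ss; exact: leq_trans ik kn.
- by rewrite inE ss.
Qed.

Lemma nth_sort_le xs k c : (k < size xs)%N ->
  ((sort <=%R xs)`_k <= c) = (k < count (fun x => (x <= c)%R) xs)%N.
Proof.
move=> kn; apply/idP/idP.
  by apply: (@nth_sort_count_down (fun x => (x <= c)%R)) => // x y; apply: le_trans.
apply: contraLR; rewrite -ltNge -leqNgt => ck.
have := @nth_sort_count_up (fun x => (c < x)%R) xs k _ kn ck.
move=> /(_ (fun x y xy cx => lt_le_trans cx xy)).
have -> : count (fun x => (c < x)%R) xs = count (predC (fun x => (x <= c)%R)) xs.
  by apply: eq_count => x /=; exact: ltNge.
move=> H; rewrite -(leq_add2r (count (predC (fun x => (x <= c)%R)) xs)) count_predC.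
by rewrite -leq_subLR.
Qed.

(** For even size, an average above [a] forces the upper middle value above [a]. Both parities thus
    reduce to position [k], from which at least half of the entries remain. *)
Lemma empirical_median_gt xs a : a < empirical_median xs ->
  (size xs <= 2 * count (fun x => (a < x)%R) xs)%N.
Proof.
rewrite /empirical_median; case: (posnP (size xs)) => [-> //|n0].
set s := sort _ _; set k := (size xs)./2.
have nk : (k < size xs)%N by rewrite /k; lia.
suff H : a < s`_k -> (size xs <= 2 * count (fun x => (a < x)%R) xs)%N.
  case: ifPn => // odd_n am; apply: H.
  suff : s`_k.-1 <= s`_k by lra.
  apply: (sorted_leq_nth le_trans le_refl) => //; last lia.
  - exact: sort_le_sorted.
  - by rewrite inE size_sort; exact: leq_ltn_trans (leq_pred _) nk.
  - by rewrite inE size_sort.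
move=> ask; have := @nth_sort_count_up (fun x => (a < x)%R) xs k _ nk ask.
move=> /(_ (fun x y xy cx => lt_le_trans cx xy)).
have half (m b : nat) : (m - m./2 <= b)%N -> (m <= 2 * b)%N by lia.
by move=> kc; apply: half; exact: kc.
Qed.

(** For even size it is the lower middle value, at position [k.-1], that lies below [a]; the strict
    bound [k.-1 < count] then gives exactly half. *)
Lemma empirical_median_lt xs a : empirical_median xs < a ->
  (size xs <= 2 * count (fun x => (x < a)%R) xs)%N.
Proof.
rewrite /empirical_median; case: (posnP (size xs)) => [-> //|n0].
set s := sort _ _; set k := (size xs)./2.
have nk : (k < size xs)%N by rewrite /k; lia.
have H j : (j < size xs)%N -> s`_j < a -> (j < count (fun x => (x < a)%R) xs)%N.
  move=> jn; apply: (@nth_sort_count_down (fun x => x < a)) => // x y.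
  exact: le_lt_trans.
case: ifPn => odd_n am.
  have := H k _ am; rewrite /k; lia.
suff /H : s`_k.-1 < a by rewrite /k; lia.
suff : s`_k.-1 <= s`_k by lra.
apply: (sorted_leq_nth le_trans le_refl) => //; last lia.
- exact: sort_le_sorted.
- by rewrite inE size_sort; exact: leq_ltn_trans (leq_pred _) nk.
- by rewrite inE size_sort.
Qed.

End OrderStatistics.

(** * Measurability of the empirical median *)

Lemma count_sum_indic (R : realType) (T : Type) n (X : 'I_n -> T -> R) (p : pred R) w :
  (count p [seq X i w | i <- enum 'I_n])%:R =
  \sum_i \1_(X i @^-1` [set x | p x]) w :> R.
Proof.
rewrite count_map -sum1_count big_mkcond big_enum natr_sum.
apply: eq_bigr => i _; rewrite indicE; case: ifPn => pX.
  by rewrite mem_set.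
by rewrite memNset //; exact/negP.
Qed.

(** The order statistic exceeds [c] iff at most [k] of the variables are at most [c], and their
    number is a sum of indicators of measurable sets. *)
Lemma measurable_nth_sort d (T : measurableType d) (R : realType) n
    (X : 'I_n -> T -> R) k : (forall i, measurable_fun setT (X i)) ->
  measurable_fun setT (fun w => (sort <=%R [seq X i w | i <- enum 'I_n])`_k).
Proof.
move=> mX; have [nk|kn] := leqP n k.
  (* Out of range, [nth] returns its default value [0]. *)
  rewrite (_ : (fun w => _) = cst 0); first exact: measurable_cst.
  by apply/funext => w; rewrite nth_default // size_sort size_map size_enum_ord.
move=> _; apply: (measurability _ (RGenOInfty.measurableE R)) => // _ [_ [c ->] <-].
rewrite setTI.
have sz w : size [seq X i w | i <- enum 'I_n] = n by rewrite size_map size_enum_ord.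
pose N w : R := \sum_i \1_(X i @^-1` [set x | x <= c]) w.
have -> : (fun w => (sort <=%R [seq X i w | i <- enum 'I_n])`_k) @^-1` `]c, +oo[
  = N @^-1` `]-oo, k%:R].
  apply/seteqP; split => w /=; rewrite !in_itv /= andbT ltNge nth_sort_le ?sz //;
    by rewrite -leqNgt -(ler_nat R) count_sum_indic.
suff mN : measurable_fun setT N by rewrite -[X in measurable X]setTI; exact: mN.
apply: measurable_sum => i; apply: measurable_indic.
rewrite -[X in measurable X]setTI; apply: (mX i) => //.
by rewrite -set_itvNyc; exact: measurable_itv.
Qed.

Lemma measurable_empirical_median d (T : measurableType d) (R : realType) n
    (X : 'I_n -> T -> R) : (forall i, measurable_fun setT (X i)) ->
  measurable_fun setT (fun w => empirical_median [seq X i w | i <- enum 'I_n]).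
Proof.
move=> mX; pose s w := sort <=%R [seq X i w | i <- enum 'I_n].
rewrite (_ : (fun w => _) = fun w =>
  if odd n then (s w)`_(n./2) else ((s w)`_(n./2).-1 + (s w)`_(n./2)) / 2); last first.
  by apply/funext => w; rewrite /empirical_median size_map size_enum_ord.
case: (odd n); first exact: measurable_nth_sort.
apply: measurable_funM; last exact: measurable_cst.
by apply: measurable_funD; exact: measurable_nth_sort.
Qed.

(** * Lower tail of the number of occurrences among independent events of equal probability *)

Section Majority.
Context d (T : measurableType d) (R : realType) (P : probability T R).
Variables (n : nat) (B : 'I_n -> set T) (p : R).
Hypothesis mB : forall i, measurable (B i).
Hypothesis PB : forall J : {set 'I_n},
  P (\bigcap_(i in [set` J]) B i) = (p ^+ #|J|)%:E.

(** Expanding the product over the subsets of indices leaves indicators of intersections, whose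
    probabilities [PB] gives. The same expansion, with the constant [p] in place of the indicators,
    resums the result. *)
Lemma integral_prod_indic (c e : R) :
  (\int[P]_w (\prod_i (c + e * \1_(B i) w))%:E = ((c + e * p) ^+ n)%:E)%E.
Proof.
pose BJ (J : {set 'I_n}) := \bigcap_(i in [set` J]) B i.
have mBJ J : measurable (BJ J).
  by apply: fin_bigcap_measurable => //; exact: finite_finset.
have expand (g : 'I_n -> R) : \prod_i (c + e * g i) =
    \sum_(J : {set 'I_n}) c ^+ (n - #|J|) * e ^+ #|J| * \prod_(i in J) g i.
  under eq_bigr do rewrite addrC.
  rewrite bigA_distr; apply: eq_bigr => J _.
  rewrite (bigID (mem J)) /=.
  under eq_bigr => i iJ do rewrite iJ.
  rewrite big_split /= prodr_const.
  under [X in _ * X]eq_bigr => i /negPf iJ do rewrite iJ.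
  rewrite prodr_const.
  have -> : #|[predC J]| = (n - #|J|)%N.
    apply/eqP; rewrite -(eqn_add2l #|J|) cardC card_ord subnKC //.
    by rewrite -[X in (_ <= X)%N]card_ord max_card.
  by rewrite mulrC mulrA.
have prod_indic (J : {set 'I_n}) w : \prod_(i in J) \1_(B i) w = \1_(BJ J) w :> R.
  rewrite [RHS]indicE; have [/set_mem BJw|/negP BJw] := boolP (w \in BJ J).
    by rewrite big1 // => i iJ; rewrite indicE mem_set //; exact: BJw.
  have [i iJ Bi] : exists2 i, i \in J & ~ B i w.
    apply: contrapT => Bi; apply: BJw; apply/mem_set => i iJ.
    by apply: contrapT => Bi'; apply: Bi; exists i.
  by rewrite (bigD1 i) //= indicE memNset // mul0r.
have int_BJ (J : {set 'I_n}) a :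
    (\int[P]_w (a%:E * (\1_(BJ J) w)%:E) = (a * p ^+ #|J|)%:E)%E.
  rewrite integralZl //; last exact: integrable_indic.
  by rewrite integral_indic // setIT EFinM; congr (_ * _)%E; exact: PB.
under eq_integral => w _.
  rewrite expand -sumEFin.
  under eq_bigr => J _ do rewrite prod_indic EFinM.
  over.
rewrite integral_sum //=; last first.
  by move=> J; apply: integrableZl => //; exact: integrable_indic.
under eq_bigr => J _ do rewrite int_BJ.
rewrite sumEFin; congr EFin.
transitivity (\prod_(i < n) (c + e * p)); last by rewrite prodr_const card_ord.
by rewrite expand; apply: eq_bigr => J _; rewrite prodr_const.
Qed.

Let few := [set w | 2 * \sum_i \1_(B i) w <= n%:R :> R].

Lemma measurable_few : measurable few.
Proof.
pose N w : R := 2 * \sum_i \1_(B i) w.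
have -> : few = N @^-1` `]-oo, n%:R].
  by apply/seteqP; split => w /=; rewrite in_itv.
suff mN : measurable_fun setT N.
  by rewrite -[X in measurable X]setTI; exact: mN.
apply: measurable_funM; first exact: measurable_cst.
by apply: measurable_sum => i; exact: measurable_indic.
Qed.

(** Each factor is [z] on [B i] and 1 elsewhere. This puts z^N in the product form of
    [integral_prod_indic], with [c = 1] and [e = z - 1]. *)
Lemma prod_indic_expr (z : R) w : exists2 k : nat,
  \sum_i \1_(B i) w = k%:R :> R &
  \prod_i (1 + (z - 1) * \1_(B i) w) = z ^+ k.
Proof.
exists (\sum_i (w \in B i))%N; first by rewrite natr_sum.
rewrite expr_sum; apply: eq_bigr => i _; rewrite indicE.
by case: (w \in B i); rewrite ?(mulr1, mulr0, addr0, expr1, expr0) // addrC subrK.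
Qed.

(* Markov's inequality for y^(2N - n), N being the number of events that occur. *)
Lemma few_le_expr (y : R) : 0 < y <= 1 ->
  (P few <= (((1 - p + p * y ^+ 2) / y) ^+ n)%:E)%E.
Proof.
move=> /andP[y0 y1].
have -> : P few = (\int[P]_w (\1_few w)%:E)%E.
  by rewrite integral_indic ?setIT //; exact: measurable_few.
have yn0 : 0 < y ^- n by rewrite invr_gt0 exprn_gt0.
have mprod : measurable_fun setT
    (fun w => \prod_i (1 + (y ^+ 2 - 1) * \1_(B i) w) : R).
  apply: measurable_prod => i _; apply: measurable_funD; first exact: measurable_cst.
  by apply: measurable_funM; [exact: measurable_cst|exact: measurable_indic].
have prod_ge0 w : 0 <= \prod_i (1 + (y ^+ 2 - 1) * \1_(B i) w) :> R.
  by have [k ? ->] := prod_indic_expr (y ^+ 2) w; rewrite exprn_ge0 // sqr_ge0.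
have -> : (1 - p + p * y ^+ 2) / y = y^-1 * (1 + (y ^+ 2 - 1) * p) by ring.
rewrite exprMn exprVn EFinM -integral_prod_indic.
rewrite -ge0_integralZl_EFin //=; last 3 first.
- by move=> w _; rewrite lee_fin.
- exact/measurable_EFinP.
- exact: ltW.
apply: ge0_le_integral => //=.
- exact/measurable_EFinP/measurable_indic/measurable_few.
- by apply/measurable_EFinP; apply: measurable_funM => //; exact: measurable_cst.
move=> w _; rewrite -EFinM lee_fin [\1_few w]indicE.
have [/set_mem few_w|?] := boolP (w \in few); last by rewrite mulr_ge0 // ltW.
have [k Nk ->] := prod_indic_expr (y ^+ 2) w.
move: few_w; rewrite /few /= Nk -natrM ler_nat => kn.
rewrite -exprM ler_pdivlMl ?exprn_gt0 // mulr1.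
by rewrite ler_wiXn2l // ltW.
Qed.

(* The choice y^2 = (1-q)/q with q = 1/2 + u turns the base of [few_le_expr] into
   2 sqrt(q(1-q)) = sqrt(1 - 4u^2) <= exp(-2u^2). *)
Lemma chernoff_few (u : R) : 0 <= u < 2^-1 -> 2^-1 + u <= p <= 1 ->
  (P few <= (expR (- (2 * u ^+ 2 * n%:R)))%:E)%E.
Proof.
move=> /andP[u0 u2] /andP[up p1].
pose q : R := 2^-1 + u; pose y := Num.sqrt ((1 - q) / q).
have q0 : 0 < q by rewrite /q; lra.
have y2 : y ^+ 2 = (1 - q) / q.
  by rewrite sqr_sqrtr // divr_ge0 //; rewrite /q; lra.
have y0 : 0 < y by rewrite sqrtr_gt0 divr_gt0 //; rewrite /q; lra.
have y1 : y <= 1.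
  rewrite -(@ler_pXn2r _ 2) ?nnegrE // ?(ltW y0) // y2 expr1n ler_pdivrMr // mul1r.
  by rewrite /q; lra.
have y01 : 0 < y <= 1 by rewrite y0.
apply: le_trans (few_le_expr y01) _.
rewrite lee_fin.
have -> : - (2 * u ^+ 2 * n%:R) = n%:R * - (2 * u ^+ 2) by ring.
rewrite expRM_natl; apply: lerXn2r; rewrite ?nnegrE ?expR_ge0 //.
  apply: divr_ge0; last exact: ltW.
  by rewrite addr_ge0 ?subr_ge0 // mulr_ge0 ?sqr_ge0 //; lra.
(* As [y ^+ 2 <= 1], the base is nonincreasing in [p], so [p] may be replaced by its lower bound
   [q]. *)
have : (1 - p + p * y ^+ 2) / y <= (1 - q + q * y ^+ 2) / y.
  rewrite ler_pM2r ?invr_gt0 //.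
  have : y ^+ 2 <= 1 by rewrite expr_le1 // ltW.
  rewrite -/q in up; nra.
move/le_trans; apply.
rewrite -(@ler_pXn2r _ 2) ?nnegrE ?expR_ge0 //; last first.
  apply: divr_ge0; last exact: ltW.
  by rewrite addr_ge0 ?subr_ge0 // ?mulr_ge0 ?sqr_ge0 // /q; lra.
have -> : ((1 - q + q * y ^+ 2) / y) ^+ 2 = 1 - 4 * u ^+ 2.
  rewrite expr_div_n y2 /q; field.
  by apply/andP; split; lra.
rewrite -expRM_natl; apply: le_trans (expR_ge1Dx _).
lra.
Qed.

End Majority.

(** * Quantiles of a distribution and growth of its cdf around the median *)

Section Quantile.
Context {R : realType} (mu : probability R R).
Implicit Types p q r x y : R.
Let F := law_cdf mu.

Lemma law_cdfE x : (F x)%:E = mu `]-oo, x]%classic.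
Proof. by rewrite fineK // fin_num_measure. Qed.

Lemma law_cdf_nondecreasing : {homo F : x y / x <= y}.
Proof.
move=> x y xy; rewrite -lee_fin !law_cdfE le_measure ?inE //.
exact: subset_itvl.
Qed.

(** Under [mu] the identity is a random variable of law [mu], which gives access to the limits at
    infinity of cdfs of random variables. *)
Let idR : R -> R := idfun.
HB.instance Definition _ := isMeasurableFun.Build _ _ _ _ idR
  (@measurable_id _ _ setT).

Lemma law_cdf_gt p : p < 1 -> exists x, p < F x.
Proof.
move=> p1.
have Fy : F @ +oo --> (1 : R) by exact/fine_cvg/(cvg_cdfy1 (idR : {RV mu >-> R})).
have px : \forall x \near +oo, p < F x by exact: cvgr_gt Fy _ p1.
by near (pinfty_nbhs R) => x; exists x; near: x.
Unshelve. all: by end_near. Qed.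

Lemma law_cdf_lt p : 0 < p -> exists x, F x < p.
Proof.
move=> p0.
have Fy : F @ -oo --> (0 : R) by exact/fine_cvg/(cvg_cdfNy0 (idR : {RV mu >-> R})).
have px : \forall x \near -oo, F x < p by exact: cvgr_lt Fy _ p0.
by near (ninfty_nbhs R) => x; exists x; near: x.
Unshelve. all: by end_near. Qed.

(** [0 < p] provides a point where [F] is below [p], hence a lower bound of the set; without one,
    [inf] would be a default value. *)
Lemma lt_quantileL p x : 0 < p -> x < quantileL F p -> F x < p.
Proof.
move=> /law_cdf_lt[y Fy]; apply: contraTT; rewrite -!leNgt => px.
apply: ge_inf => //; exists y => z /= pz.
by apply: contraTT (lt_le_trans Fy pz); rewrite -ltNge -leNgt => /ltW/law_cdf_nondecreasing.
Qed.

Lemma gt_quantileL p x : p < 1 -> quantileL F p < x -> p <= F x.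
Proof.
move=> /law_cdf_gt[y Fy] /inf_lt[|z pz zx]; first by exists y; exact: ltW.
by apply: le_trans pz _; exact/law_cdf_nondecreasing/ltW.
Qed.

Lemma gt_quantileR p x : p < 1 -> quantileR F p < x -> p < F x.
Proof.
move=> /law_cdf_gt[y Fy] /inf_lt[|z pz zx]; first by exists y.
by apply: lt_le_trans pz _; exact/law_cdf_nondecreasing/ltW.
Qed.

(** Otherwise the midpoint [x] of the two quantiles would satisfy both [F x < p] and [q <= F x]. *)
Lemma le_quantileL p q : 0 < p -> p <= q < 1 -> quantileL F p <= quantileL F q.
Proof.
move=> p0 /andP[pq q1]; rewrite leNgt; apply/negP => lt_qp.
have := midf_lt lt_qp; set x := _ / _ => -[qx xp].
have := lt_quantileL p0 xp; have := gt_quantileL q1 qx; lra.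
Qed.

Lemma le_quantileLR p q : 0 < p -> p <= q < 1 -> quantileL F p <= quantileR F q.
Proof.
move=> p0 /andP[pq q1]; rewrite leNgt; apply/negP => lt_qp.
have := midf_lt lt_qp; set x := _ / _ => -[qx xp].
have := lt_quantileL p0 xp; have := gt_quantileR q1 qx; lra.
Qed.

Section Slope.
Variables (tbar k : R).
Hypotheses (tbar0 : 0 < tbar) (tbar2 : tbar < 2^-1) (k0 : 0 < k).
Hypothesis slope : forall x1 x2 : R,
  quantileL F (2^-1 - tbar) <= x1 <= quantileR F (2^-1 + tbar) ->
  quantileL F (2^-1 - tbar) <= x2 <= quantileR F (2^-1 + tbar) ->
  k * `|x1 - x2| <= `|F x1 - F x2|.

Lemma slope_le x y : quantileL F (2^-1 - tbar) <= x -> x <= y ->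
  y <= quantileR F (2^-1 + tbar) -> k * (y - x) <= F y - F x.
Proof.
move=> Qx xy yQ.
rewrite -[y - x]ger0_norm ?subr_ge0 // -[F y - F x]ger0_norm.
  by apply: slope; rewrite ?yQ ?Qx ?(le_trans xy yQ) ?(le_trans Qx xy).
by rewrite subr_ge0 law_cdf_nondecreasing.
Qed.

Let Qm : quantileL F (2^-1 - tbar) <= median F.
Proof. by move: tbar0 tbar2 => ? ?; apply: le_quantileL; [|apply/andP; split]; lra. Qed.

Let mQ : median F <= quantileR F (2^-1 + tbar).
Proof. by move: tbar0 tbar2 => ? ?; apply: le_quantileLR; [|apply/andP; split]; lra. Qed.

(** Beyond the right quantile, [F] is at least [2^-1 + tbar]; up to it, the growth condition applies
    to the right of the median. *)
Lemma law_cdf_above_median r : 0 < r ->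
  2^-1 + Num.min tbar (k * r) <= F (median F + r).
Proof.
move: tbar0 tbar2 k0 Qm mQ => t0 t2 k_gt0 Qm' mQ' r0.
have [aQ|Qa] := leP (median F + r) (quantileR F (2^-1 + tbar)); last first.
  apply: le_trans (ltW (gt_quantileR _ Qa)); last by lra.
  by rewrite lerD2l ge_min lexx.
apply: (@le_trans _ _ (2^-1 + k * r)); first by rewrite lerD2l ge_min lexx orbT.
(* [gt_quantileL] yields 1/2 only strictly to the right of the median, so growth is measured from
   distance [s], at a cost [k * s <= e] with [e] arbitrary. *)
apply/ler_addgt0Pr => e e0; pose s := Num.min r (e / k).
have s0 : 0 < s by rewrite lt_min r0 divr_gt0.
have sr : s <= r by rewrite ge_min lexx.
have ks : k * s <= e by rewrite mulrC -ler_pdivlMr // ge_min lexx orbT.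
have := @gt_quantileL 2^-1 (median F + s) _ _; rewrite ltrDl => /(_ _ s0) Fs.
have := @slope_le (median F + s) (median F + r) _ _ aQ.
have -> : median F + r - (median F + s) = r - s by ring.
rewrite mulrBr lerD2l; move=> /(_ _ sr) sl.
have {}Fs : 2^-1 <= F (median F + s) by apply: Fs; lra.
have {}sl : k * r - k * s <= F (median F + r) - F (median F + s) by apply: sl; lra.
lra.
Qed.

Lemma law_cdf_below_median r : 0 < r ->
  F (median F - r) <= 2^-1 - Num.min tbar (k * r).
Proof.
move: tbar0 tbar2 k0 Qm mQ => t0 t2 k_gt0 Qm' mQ' r0.
have [aQ|Qa] := leP (quantileL F (2^-1 - tbar)) (median F - r); last first.
  apply: le_trans (ltW (lt_quantileL _ Qa)) _; first by lra.
  by rewrite lerD2l lerN2 ge_min lexx.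
apply: (@le_trans _ _ (2^-1 - k * r)); last by rewrite lerD2l lerN2 ge_min lexx orbT.
(* An atom at the median may lift [F] above 1/2 there, so growth is measured from [median F - s]. *)
apply/ler_addgt0Pr => e e0; pose s := Num.min r (e / k).
have s0 : 0 < s by rewrite lt_min r0 divr_gt0.
have sr : s <= r by rewrite ge_min lexx.
have ks : k * s <= e by rewrite mulrC -ler_pdivlMr // ge_min lexx orbT.
have Fs : F (median F - s) < 2^-1.
  by apply: lt_quantileL; rewrite -/(median F) ?ltrBlDr; lra.
have : k * ((median F - s) - (median F - r)) <= F (median F - s) - F (median F - r).
  by apply: slope_le => //; lra.
have -> : median F - s - (median F - r) = r - s by ring.
rewrite mulrBr; lra.
Qed.

End Slope.
End Quantile.

(** * Uncontaminated observations and their independence *)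

Section Contamination.
Context (R : realType) (eps : R) (F : probability R R).
Context d (Omega : measurableType d) (P : probability Omega R) (n : nat).
Variables (Y : 'I_n -> {RV P >-> R}) (D : 'I_n -> {RV P >-> bool}).
Variable Z : 'I_n -> {RV P >-> R}.
Hypothesis eps01 : 0 <= eps <= 1.
Hypothesis hY : forall i, has_law (Y i) F.
Hypothesis hD : forall i, has_law (D i) (bernoulli_prob eps).
Hypothesis hYD : jointly_independent Y D.

(* On [clean A i] the [i]-th observation is uncorrupted and lies in [A], whatever
   [Z i] is; these events are independent, whereas the events [X_i \in A] need not be. *)
Definition clean (A : set R) i := D i @^-1` [set false] `&` Y i @^-1` A.

Lemma measurable_clean A i : measurable A -> measurable (clean A i).
Proof. by move=> mA; apply: measurableI; exact: measurable_funPTI. Qed.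

(** Joint independence is applied to two copies of [J], one for the [Y i] and one for the [D i]; the
    product splits into powers of [fine (F A)] and [1 - eps]. *)
Lemma prob_cap_clean A (J : {set 'I_n}) : measurable A ->
  P (\bigcap_(i in [set` J]) clean A i) = (((1 - eps) * fine (F A)) ^+ #|J|)%:E.
Proof.
move=> mA.
pose J2 := [set k : 'I_n + 'I_n | match k with inl i | inr i => i \in J end]%SET.
pose C (k : 'I_n + 'I_n) := match k with
  | inl i => Y i @^-1` A | inr i => D i @^-1` [set false] end.
have genC k : k \in J2 -> match k with
    | inl i => generated_events (Y i) | inr i => generated_events (D i) end (C k).
  by case: k => i _ /=; [exists A|exists [set false]] => //; rewrite setTI.
have := hYD genC.
rewrite (_ : \bigcap_(k in _) C k = \bigcap_(i in [set` J]) clean A i); last first.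
  apply/seteqP; split => w Cw.
    move=> i /= iJ; split.
      by apply: (Cw (inr i)); rewrite /= inE.
    by apply: (Cw (inl i)); rewrite /= inE.
  by case=> i; rewrite /= inE => /Cw[].
move=> ->; rewrite big_sumType /=.
under eq_bigl do rewrite inE.
under [X in (_ * X)%E]eq_bigl do rewrite inE.
under eq_bigr do rewrite [P _]hY // -[F A]fineK ?fin_num_measure //.
under [X in (_ * X)%E]eq_bigr.
  move=> i _; rewrite [P _]hD // bernoulli_probE //.
  rewrite diracE memNset // mule0 add0e diracE mem_set // mule1.
  over.
by rewrite !prodEFin !prodr_const -EFinM -exprMn mulrC.
Qed.

(** At a clean index the observation equals [Y i] and fails [p], so each index contributes at most 1
    to the two counts together. *)
Lemma sum_clean_le_half (p : pred R) w :
  (n <= 2 * count p [seq contaminate Y D Z i w | i <- enum 'I_n])%N ->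
  2 * \sum_i \1_(clean [set x | ~~ p x] i) w <= n%:R :> R.
Proof.
rewrite -(ler_nat R) natrM count_sum_indic => np.
suff : \sum_i \1_(clean [set x | ~~ p x] i) w
     + \sum_i \1_(contaminate Y D Z i @^-1` [set x | p x]) w <= n%:R :> R.
  by move: np; set a := \sum_i _; set b := \sum_i _; lra.
rewrite -big_split /=.
have -> : n%:R = \sum_(i < n) 1 :> R by rewrite sumr_const card_ord.
apply: ler_sum => i _; rewrite !indicE.
have [/set_mem[/= Di Yi]|_] := boolP (w \in clean _ i).
  rewrite memNset ?addr0 //= /contaminate Di subr0 mul1r mul0r addr0.
  exact/negP.
by rewrite add0r; case: (_ \in _).
Qed.

(** This is [chernoff_few] with u = (1 - eps) t: the factor [1 - eps] turns 1/2 + eps / (2 (1 -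
    eps)) + t into exactly 1/2 + (1 - eps) t. *)
Lemma prob_clean_minority (A : set R) (t : R) :
    measurable A -> 0 <= t -> (1 - eps) * t < 2^-1 ->
    eps < 1 -> 2^-1 + eps / (2 * (1 - eps)) + t <= fine (F A) ->
  (P [set w | (2 * \sum_i \1_(clean A i) w <= n%:R :> R)%R]
    <= (expR (- (2 * ((1 - eps) * t) ^+ 2 * n%:R)))%:E)%E.
Proof.
move=> mA t0 t2 eps1 FA.
have FA1 : fine (F A) <= 1.
  by rewrite -lee_fin fineK ?fin_num_measure // probability_le1.
apply: (chernoff_few (p := (1 - eps) * fine (F A))).
- by move=> i; exact: measurable_clean.
- by move=> J; exact: prob_cap_clean.
- by rewrite t2 mulr_ge0 //; lra.
move: eps01 => /andP[e0 e1]; apply/andP; split; last by nra.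
apply: (@le_trans _ _ ((1 - eps) * (2^-1 + eps / (2 * (1 - eps)) + t))); last first.
  by apply: ler_wpM2l => //; lra.
rewrite le_eqVlt; apply/orP; left; apply/eqP; field.
lra.
Qed.

End Contamination.

(** * Union bound over the two tails *)

Theorem corollary12 (R : realType) (tbar B eps : R) (F : probability R R) (m2 : R)
    (d : measure_display) (Omega : measurableType d) (P : probability Omega R)
    (n : nat) (Y : 'I_n -> {RV P >-> R}) (D : 'I_n -> {RV P >-> bool})
    (Z : 'I_n -> {RV P >-> R}) (delta E : R)
    (htbar : 0 < tbar < 2^-1) (hB : 0 < B)
    (heps : 0 < eps < 2 * tbar / (1 + 2 * tbar))
    (hF : in_family tbar B F m2)
    (hY : forall i, has_law (Y i) F)
    (hD : forall i, has_law (D i) (bernoulli_prob eps))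
    (hYD : jointly_independent Y D)
    (hdelta : 0 < delta < 1) (hE : 0 < E)
    (hn : 2 * Num.max (B ^+ 2 * m2 ^+ 2 / E ^+ 2)
                      ((tbar - eps / (2 * (1 - eps))) ^- 2)
            * ln (2 / delta) <= n%:R) :
  ((1 - delta)%:E <=
    P [set w | (`|empirical_median [seq contaminate Y D Z i w | i <- enum 'I_n]
                  - median (law_cdf F)|
                <= B * m2 * (eps / (2 * (1 - eps))) + E)%R])%E.
Proof.
case: hF => _ _ m2_gt0 slope.
case/andP: htbar => tbar0 tbar2; case/andP: heps => eps0.
rewrite ltr_pdivlMr => [heps2|]; last by lra.
have epsh : eps < 2^-1 by nra.
set e := eps / (2 * (1 - eps)).
(* This is the upper bound on [eps], solved for [tbar]. *)
have e_tbar : e < tbar by rewrite /e ltr_pdivrMr; nra.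
have e0 : 0 < e by rewrite /e divr_gt0 //; lra.
have Bm : 0 < B * m2 by rewrite mulr_gt0.
pose r := B * m2 * e + E.
have r0 : 0 < r by rewrite addr_gt0 // mulr_gt0.
pose t := Num.min (tbar - e) (E / (B * m2)).
have t0 : 0 < t by rewrite lt_min subr_gt0 e_tbar divr_gt0.
have t_tbar : t <= tbar - e by rewrite ge_min lexx.
(* Over a distance [r] the cdf gains at least [e + t]: [e] absorbs the contamination, and [t] is the
   margin left for the Chernoff bound. *)
have et : Num.min tbar (1 / (B * m2) * r) = e + t.
  rewrite /t addr_minr; congr Num.min; first by ring.
  by rewrite /r; field; rewrite !gt_eqF.
have k0 : 0 < 1 / (B * m2) by rewrite divr_gt0.
have Fup := law_cdf_above_median tbar0 tbar2 k0 slope r0.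
have Fdown := law_cdf_below_median tbar0 tbar2 k0 slope r0.
rewrite et in Fup Fdown.
set m := median _ in Fup Fdown *.
have eps01 : 0 <= eps <= 1 by apply/andP; split; lra.
have tail (A : set R) : measurable A -> 2^-1 + e + t <= fine (F A) ->
    (P [set w | (2 * \sum_i \1_(clean Y D A i) w <= n%:R :> R)%R] <= (delta / 2)%:E)%E.
  move=> mA FA; have u2 : (1 - eps) * t < 2^-1 by nra.
  have eps1 : eps < 1 by lra.
  apply: le_trans (prob_clean_minority eps01 hY hD hYD mA (ltW t0) u2 eps1 FA) _.
  rewrite lee_fin; case/andP: hdelta => d0 d1.
  have -> : delta / 2 = expR (- ln (2 / delta)).
    by rewrite expRN lnK ?posrE ?divr_gt0 // invf_div.
  rewrite ler_expR lerN2.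
  have ln0 : 0 <= ln (2 / delta) by rewrite ln_ge0 // ler_pdivlMr //; lra.
  (* The two terms of the maximum in [hn] are the inverse squares of the two terms of the minimum
     [t], so t^2 N >= 1. *)
  have t2n : 2 * ln (2 / delta) <= t ^+ 2 * n%:R.
    apply: le_trans (ler_wpM2l (sqr_ge0 t) hn).
    set N := Num.max _ _; have -> : t ^+ 2 * (2 * N * ln (2 / delta)) =
      t ^+ 2 * N * (2 * ln (2 / delta)) by ring.
    rewrite ler_peMl ?mulr_ge0 // mulrC -ler_pdivrMr ?exprn_gt0 // mul1r le_max /t.
    case: (leP (tbar - e) (E / (B * m2))) => _; first by rewrite lexx orbT.
    by rewrite expr_div_n invf_div exprMn lexx.
  (* By [epsh]. The exponent 2 (1 - eps)^2 t^2 n is then at least t^2 n / 2, hence at least ln(2 /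
     delta). *)
  have : 4^-1 <= (1 - eps) ^+ 2 by nra.
  rewrite exprMn; nra.
pose M w := empirical_median [seq contaminate Y D Z i w | i <- enum 'I_n].
have mX i : measurable_fun setT (contaminate Y D Z i).
  have mD : measurable_fun setT (fun w => (D i w)%:R : R).
    have mnat : measurable_fun setT (fun b : bool => b%:R : R) by [].
    exact: (measurableT_comp mnat).
  apply: measurable_funD; apply: measurable_funM => //.
  by apply: measurable_funB => //; exact: measurable_cst.
have mM : measurable_fun setT M by exact: measurable_empirical_median.
(* Both half-lines are written as negated predicates, the form in which [sum_clean_le_half] produces
   them. *)
pose le_up := [set x : R | ~~ (m + r < x)].
pose ge_down := [set x : R | ~~ (x < m - r)].
have le_upE : le_up = `]-oo, (m + r)]%classic.
  by rewrite set_itvNyc; apply/funext => x; rewrite /le_up /= -leNgt.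
have ge_downE : ge_down = ~` `]-oo, (m - r)[%classic.
  by rewrite set_itvNyo; apply/seteqP; split=> x /negP.
have mle_up : measurable le_up by rewrite le_upE; exact: measurable_itv.
have mge_down : measurable ge_down.
  by rewrite ge_downE; apply: measurableC; exact: measurable_itv.
pose up := [set w | 2 * \sum_i \1_(clean Y D le_up i) w <= n%:R :> R].
pose down := [set w | 2 * \sum_i \1_(clean Y D ge_down i) w <= n%:R :> R].
have mup : measurable up.
  by apply: measurable_few => i; exact: measurable_clean.
have mdown : measurable down.
  by apply: measurable_few => i; exact: measurable_clean.
set good := [set w | _].
have mgood : measurable good.
  have -> : good = (fun w => `|M w - m|) @^-1` `]-oo, r].
    by apply/seteqP; split => w /=; rewrite in_itv.
  rewrite -[X in measurable X]setTI.
  apply: (measurableT_comp (@normr_measurable R setT)) => //.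
  by apply: measurable_funB => //; exact: measurable_cst.
have bad : ~` good `<=` up `|` down.
  move=> w /negP; rewrite -ltNge -/(M w) -/r ltr_normr => /orP[].
    rewrite ltrBrDl => /empirical_median_gt; rewrite size_map size_enum_ord => nup.
    by left; exact: (sum_clean_le_half (p := fun x => m + r < x)) nup.
  rewrite opprB ltrBrDl -ltrBrDr => /empirical_median_lt.
  rewrite size_map size_enum_ord => ndown.
  by right; exact: (sum_clean_le_half (p := fun x => x < m - r)) ndown.
have Pup : (P up <= (delta / 2)%:E)%E.
  by apply: tail => //; rewrite le_upE -addrA.
have Pdown : (P down <= (delta / 2)%:E)%E.
  apply: tail => //.
  rewrite ge_downE probability_setC ?fineB ?fin_num_measure //=.
  (* [ge_down] contains its endpoint, so its mass is at least [1 - law_cdf F (m - r)], to which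
     [Fdown] applies. *)
  have : fine (F `]-oo, (m - r)[%classic) <= law_cdf F (m - r).
    rewrite fine_le ?fin_num_measure // le_measure ?inE //.
    by move=> x /=; rewrite !in_itv /=; exact: ltW.
  lra.
have : (P (~` good) <= delta%:E)%E.
  apply: le_trans (le_measure _ _ _ bad) _; rewrite ?inE //; last 1 first.
  - apply: le_trans (measureU2 _ _ _) _ => //.
    by rewrite [delta in leRHS]splitr EFinD leeD.
  - exact: measurableC.
  - exact: measurableU.
rewrite probability_setC // -[P good]fineK ?fin_num_measure //.
rewrite -EFinB !lee_fin; lra.
Qed.
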